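(* Consider the generalized heat equation $$\dot\varrho_t=b^{-2}\Delta\varrho_t-a^{-2}\langle\log\varrho_t,p\rangle_\varpi\,p$$ posed on $\mathcal{M}_+$. The semigroup induced by this equation is the gradient flow of the entropy $\mathbb{H}$ with respect to the Riemannian metric $\mathbf{g}$; that is, it is the flow of $\dot\varrho_t=-\mathrm{grad}\,\mathbb{H}(\varrho_t)$, where $\mathrm{grad}$ denotes the gradient on $\mathcal{M}_+$ with respect to $\mathbf{g}$.
   Context: Setting. $\mathcal{X}$ is a finite set with $N$ points, $K:\mathcal{X}\times\mathcal{X}\to[0,\infty)$ is an irreducible Markov kernel (row-stochastic matrix), and $\varpi:\mathcal{X}\to[0,\infty)$ is its unique steady-state probability distribution ($\varpi(x)=\sum_{y}\varpi(y)K(y,x)$, $\sum_y\varpi(y)=1$). $\varpi$ is assumed reversible: $K(x,y)\varpi(x)=K(y,x)\varpi(y)$ for all $x,y$. $\mathcal{M}=\{\mu:\mathcal{X}\to\mathbb{R}\mid \mu(x)\ge 0\ \forall x\}$ and $\mathcal{M}_+=\{\mu:\mathcal{X}\to\mathbb{R}\mid\mu(x)>0\ \forall x\}$, an open subset of $\mathbb{R}^{\mathcal{X}}$ with $T_\mu\mathcal{M}_+=\mathbb{R}^{\mathcal{X}}$. Fixed throughout: real numbers $a,b>0$ and $p\in\mathcal{M}_+$ with $\sum_x\varpi(x)p(x)=1$. Notation: $\langle\varphi,\psi\rangle_\varpi=\sum_x\varphi(x)\psi(x)\varpi(x)$ for $\varphi,\psi\in\mathbb{R}^{\mathcal{X}}$;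 $\log\varrho$ is taken pointwise; $\nabla\psi(x,y)=\psi(y)-\psi(x)$; for $\Psi\in\mathbb{R}^{\mathcal{X}\times\mathcal{X}}$, $(\nabla\cdot\Psi)(x)=\frac12\sum_y(\Psi(x,y)-\Psi(y,x))K(x,y)$; $\Delta\psi=\nabla\cdot\nabla\psi$, i.e. $\Delta\psi(x)=\sum_yK(x,y)(\psi(y)-\psi(x))$. Logarithmic mean: $\theta(u,u)=u$ and $\theta(u,v)=\frac{u-v}{\log u-\log v}$ for $u\neq v$, $u,v>0$ (and $\theta(u,v)=0$ if $u=0$ or $v=0$). For $\mu\in\mathcal{M}$, $\hat\mu(x,y)=\theta(\mu(x),\mu(y))$; $\langle\Phi,\Psi\rangle_\mu=\frac12\sum_{x,y}\Phi(x,y)\Psi(x,y)\hat\mu(x,y)K(x,y)\varpi(x)$; $(\nabla_\mu\cdot\Psi)(x)=\frac12\sum_y(\Psi(x,y)-\Psi(y,x))\hat\mu(x,y)K(x,y)$. Riemannian metric: for $\mu\in\mathcal{M}_+$ and every $\rho\in\mathbb{R}^{\mathcal{X}}$ there is a unique pair $(\nabla\psi_\rho,h_\rho)$, consisting of a discrete gradient and a real number, with $\rho+\nabla_\mu\cdot\nabla\psi_\rho=h_\rho\,p$. The smooth Riemannian metric $\mathbf{g}$ on $\mathcal{M}_+$ is $\mathbf{g}_\mu(\rho,\xi)=a^2h_\rho h_\xi+b^2\langle\nabla\psi_\rho,\nabla\psi_\xi\rangle_\mu$. Entropy: $\mathbb{H}(\mu)=\sum_{x\in\mathcal{X}}(\mu(x)\log\mu(x)-\mu(x))\varpi(x)$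 (with $0\log0=0$). *)

(* Defs.v *)
From HB Require Import structures.
From mathcomp Require Import all_boot all_order all_algebra.
From mathcomp Require Import all_classical all_reals all_analysis.

Set Implicit Arguments.
Unset Strict Implicit.
Unset Printing Implicit Defensive.

Import Order.TTheory GRing.Theory Num.Theory.
Import numFieldNormedType.Exports.

Local Open Scope classical_set_scope.
Local Open Scope ring_scope.

(* The state space X, a set with N points, is 'I_N. A function on X is a row
   vector mu : 'rV_N, with value mu 0 x at x; a function on X * X is a matrix. *)

Section Markov_kernel.
Context {R : realType} {N : nat}.
Implicit Types (K : 'M[R]_N) (varpi : 'rV[R]_N).

Definition markov_kernel K : Prop :=
  (forall x y, 0 <= K x y) /\ (forall x, \sum_y K x y = 1).

Definition irreducible_kernel K : Prop :=
  forall x y, exists k : nat, 0 < (K ^+ k) x y.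

Definition steady_state K varpi : Prop :=
  [/\ forall x, 0 <= varpi 0 x,
      forall x, varpi 0 x = \sum_y varpi 0 y * K y x
    & \sum_y varpi 0 y = 1].

Definition reversible K varpi : Prop :=
  forall x y, K x y * varpi 0 x = K y x * varpi 0 y.

End Markov_kernel.

Section Discrete_calculus.
Context {R : realType} {N : nat}.
Variables (K : 'M[R]_N) (varpi : 'rV[R]_N).
Implicit Types (mu phi psi : 'rV[R]_N) (Phi Psi : 'M[R]_N).

Definition Mplus : set 'rV[R]_N := [set mu | forall x, 0 < mu 0 x].

Definition vlog mu : 'rV[R]_N := map_mx (@ln R) mu.

Definition inner phi psi : R := \sum_x phi 0 x * psi 0 x * varpi 0 x.

Definition dgrad psi : 'M[R]_N := \matrix_(x, y) (psi 0 y - psi 0 x).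

Definition ddiv Psi : 'rV[R]_N :=
  \row_x (2^-1 * \sum_y (Psi x y - Psi y x) * K x y).

Definition laplacian psi : 'rV[R]_N := ddiv (dgrad psi).

Definition logmean (u v : R) : R :=
  if (u == 0) || (v == 0) then 0
  else if u == v then u else (u - v) / (ln u - ln v).

Definition hat mu : 'M[R]_N := \matrix_(x, y) logmean (mu 0 x) (mu 0 y).

Definition inner_at mu Phi Psi : R :=
  2^-1 * \sum_x \sum_y Phi x y * Psi x y * hat mu x y * K x y * varpi 0 x.

Definition ddiv_at mu Psi : 'rV[R]_N :=
  \row_x (2^-1 * \sum_y (Psi x y - Psi y x) * hat mu x y * K x y).

(* [ln] vanishes at 0, so the convention 0 log 0 = 0 holds. *)
Definition entropy mu : R :=
  \sum_x (mu 0 x * ln (mu 0 x) - mu 0 x) * varpi 0 x.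

End Discrete_calculus.

Section Riemannian_metric.
Context {R : realType} {N : nat}.
Variables (K : 'M[R]_N) (varpi p : 'rV[R]_N) (a b : R).
Implicit Types (mu rho xi G : 'rV[R]_N).

Definition decomposition mu rho : set ('M[R]_N * R) :=
  [set w | (exists psi, w.1 = dgrad psi) /\
           rho + ddiv_at K mu w.1 = w.2 *: p].

(* For mu in [Mplus] the set [decomposition mu rho] is a singleton, and this is
   its element (nabla psi_rho, h_rho). *)
Definition decomp mu rho : 'M[R]_N * R := xget (0, 0) (decomposition mu rho).

Definition metric mu rho xi : R :=
  a ^+ 2 * ((decomp mu rho).2 * (decomp mu xi).2) +
  b ^+ 2 * inner_at K varpi mu (decomp mu rho).1 (decomp mu xi).1.

(* [G] is the g-gradient of [f] at [mu]; the tangent space to [Mplus] at [mu]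
   is all of 'rV[R]_N. *)
Definition is_riem_grad (f : 'rV[R]_N -> R) mu G : Prop :=
  differentiable f mu /\ forall v, metric mu G v = 'd f mu v.

Definition riem_grad (f : 'rV[R]_N -> R) mu : 'rV[R]_N :=
  xget 0 [set G | is_riem_grad f mu G].

Definition heat_field mu : 'rV[R]_N :=
  b ^- 2 *: laplacian K mu - (a ^- 2 * inner varpi (vlog mu) p) *: p.

End Riemannian_metric.

Section Flows.
Context {R : realType} {N : nat}.
Variable F : 'rV[R]_N -> 'rV[R]_N.

(* [rho] is a solution in [Mplus] of rho' = F(rho) on the interval [I]. *)
Definition solution (I : interval R) (rho : R -> 'rV[R]_N) : Prop :=
  [/\ forall t, t \in I -> Mplus (rho t),
      {within [set` I], continuous rho}
    & forall t, ([set` I]° : set R) t -> is_derive t 1 rho (F (rho t))].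

(* [S t mu] is the value at time t >= 0 of the solution of rho' = F(rho) in
   [Mplus] that starts at [mu]; values outside t >= 0 and [Mplus] are
   irrelevant. The last clause, uniqueness, determines [S] from [F]. *)
Definition induced_semigroup (S : R -> 'rV[R]_N -> 'rV[R]_N) : Prop :=
  [/\ forall mu, Mplus mu -> S 0 mu = mu,
      forall s t mu, 0 <= s -> 0 <= t -> Mplus mu -> S (s + t) mu = S s (S t mu),
      forall mu, Mplus mu -> solution `[0, +oo[ (S ^~ mu)
    & forall (T : R) rho, 0 <= T -> solution `[0, T] rho ->
        forall t, t \in `[0, T] -> rho t = S t (rho 0)].

End Flows.

(* Main.v *)
(* For mu > 0 put G_f = a^-2 <f, p> p - b^-2 nabla_mu . nabla f, whose
   decomposition is (b^-2 nabla f, a^-2 <f, p>); integration by parts gives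
   g_mu(G_f, v) = <f, v>_varpi. The map f |-> G_f is injective: pairing
   G_f = 0 with the constant 1 gives <f, p> = 0, the Dirichlet form then
   vanishes at f, and irreducibility makes f a constant c with
   0 = <f, p> = c. Hence it is bijective, which yields both the existence of
   decompositions and the uniqueness of gradients. Finally dH_mu = <log mu, .>,
   and the logarithmic mean is chosen so that
   nabla_mu . nabla log mu = Delta mu, so grad H = G_(log mu) is minus the heat
   field. *)
Require Import Defs.
From HB Require Import structures.
From mathcomp Require Import all_boot all_order all_algebra.
From mathcomp Require Import all_classical all_reals all_analysis.
From mathcomp Require Import ring.

Import Order.TTheory GRing.Theory Num.Theory.
Import numFieldNormedType.Exports.

Local Open Scope classical_set_scope.
Local Open Scope ring_scope.

(** * Irreducible kernels and full support of the steady state *)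

Section Irreducible_kernels.
Context {R : realType} {N : nat} (K : 'M[R]_N).
Hypothesis K_markov : markov_kernel K.
Hypothesis K_irreducible : irreducible_kernel K.

(** Induction on the length [k] of a path from [x] to [y]: a positive entry of [K ^+ k.+1] contains
    a positive summand, that is, a first step to some [z] followed by a path of length [k]. *)
Lemma irreducible_closed_set (P : set 'I_N) (x : 'I_N) :
  (forall y z, P y -> 0 < K y z -> P z) -> P x -> forall y, P y.
Proof.
case: K_markov => K_ge0 _ closedP Px y.
have [k] := K_irreducible x y; elim: k x Px => [|k IHk] x Px.
  by rewrite expr0 mxE; case: eqP => [<-//|_]; rewrite ltxx.
rewrite exprS -mulmxE mxE => sum_gt0.
have Kk_ge0 m u v : 0 <= (K ^+ m) u v.
  elim: m u => [|m IHm] u; first by rewrite expr0 mxE ler0n.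
  by rewrite exprS -mulmxE mxE sumr_ge0 // => w _; rewrite mulr_ge0.
have [||z /=] := @psumr_neq0P _ _ xpredT (fun z => K x z * (K ^+ k) z y).
- by move=> z _; rewrite mulr_ge0.
- by apply/eqP; rewrite gt_eqF.
move=> Kz; apply: (IHk z).
- apply: closedP Px _; rewrite lt_def K_ge0 andbT.
  by apply: contraTneq Kz => ->; rewrite mul0r ltxx.
- rewrite lt_def Kk_ge0 andbT.
  by apply: contraTneq Kz => ->; rewrite mulr0 ltxx.
Qed.

(** The support of [varpi] is nonempty since the total mass is 1, and stationarity makes it closed
    under transitions of positive probability. *)
Lemma steady_state_gt0 (varpi : 'rV[R]_N) :
  steady_state K varpi -> forall x, 0 < varpi 0 x.
Proof.
case: K_markov => K_ge0 _ [varpi_ge0 varpi_inv varpi_mass] x.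
have [||y /= varpi_y] := @psumr_neq0P _ _ xpredT (fun y => varpi 0 y).
- by move=> y _.
- by rewrite varpi_mass; apply/eqP/oner_neq0.
apply: (irreducible_closed_set (fun z => 0 < varpi 0 z)) varpi_y x.
move=> u v vu Kuv.
rewrite varpi_inv (bigD1 u) //= ltr_pwDl ?mulr_gt0 //.
by rewrite sumr_ge0 // => w _; rewrite mulr_ge0.
Qed.

End Irreducible_kernels.

(** * The logarithmic mean *)

Section Logarithmic_mean.
Context {R : realType}.
Implicit Types u v : R.

Lemma logmeanC u v : logmean u v = logmean v u.
Proof.
rewrite /logmean orbC [u == v]eq_sym; case: ifP => // _.
have [->//|_] := eqVneq v u.
by rewrite -[in RHS]opprB -[ln v - _]opprB invrN mulrNN.
Qed.

Lemma logmean_mul_lnB u v :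
  0 < u -> 0 < v -> logmean u v * (ln v - ln u) = v - u.
Proof.
move=> u0 v0; rewrite /logmean (gt_eqF u0) (gt_eqF v0) /=.
have [->|uv] := eqVneq u v; first by rewrite !subrr mulr0.
rewrite -[ln v - _]opprB mulrN divfK ?opprB // subr_eq0.
by apply: contra_neq uv; apply: ln_inj; rewrite posrE.
Qed.

Lemma logmean_gt0 u v : 0 < u -> 0 < v -> 0 < logmean u v.
Proof.
move=> u0 v0; rewrite /logmean (gt_eqF u0) (gt_eqF v0) /=.
case: (ltgtP u v) => // uv.
- rewrite -[u - v]opprB -[ln u - _]opprB invrN mulrNN.
  by rewrite divr_gt0 // subr_gt0 // ltr_ln ?posrE.
- by rewrite divr_gt0 // subr_gt0 // ltr_ln ?posrE.
Qed.

End Logarithmic_mean.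

(** * The inner product weighted by [varpi] *)

Section Inner_product.
Context {R : realType} {N : nat} (varpi : 'rV[R]_N).
Implicit Types f g : 'rV[R]_N.

Lemma innerC f g : inner varpi f g = inner varpi g f.
Proof. by apply: eq_bigr => x _; rewrite [f 0 x * _]mulrC. Qed.

Lemma inner_linear f k g g' :
  inner varpi f (k *: g + g') = k * inner varpi f g + inner varpi f g'.
Proof.
rewrite mulr_sumr -big_split; apply: eq_bigr => x _ /=.
by rewrite !mxE; ring.
Qed.

Lemma inner0 f : inner varpi f 0 = 0.
Proof. by apply: big1 => x _; rewrite mxE mulr0 mul0r. Qed.

Lemma inner_delta f x : inner varpi f (delta_mx 0 x) = f 0 x * varpi 0 x.
Proof.
rewrite /inner (bigD1 x) //= big1 ?addr0 ?mxE ?eqxx ?mulr1 // => y /negPf yx.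
by rewrite mxE eqxx yx mulr0 mul0r.
Qed.

Lemma inner_const c f :
  inner varpi (const_mx c) f = c * \sum_x varpi 0 x * f 0 x.
Proof.
by rewrite mulr_sumr; apply: eq_bigr => x _; rewrite mxE; ring.
Qed.

End Inner_product.

(** * Integration by parts and uniqueness of decompositions *)

Section Weighted_laplacian.
Context {R : realType} {N : nat} (K : 'M[R]_N) (varpi mu : 'rV[R]_N).
Hypothesis K_markov : markov_kernel K.
Hypothesis K_irreducible : irreducible_kernel K.
Hypothesis varpi_steady : steady_state K varpi.
Hypothesis varpi_reversible : reversible K varpi.
Hypothesis mu_gt0 : Mplus mu.
Implicit Types phi psi : 'rV[R]_N.

Lemma ddiv_at_dgradE psi x :
  ddiv_at K mu (dgrad psi) 0 x =
  \sum_y (psi 0 y - psi 0 x) * hat mu x y * K x y.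
Proof.
rewrite mxE mulr_sumr; apply: eq_bigr => y _; rewrite !mxE.
by field.
Qed.

Lemma dgrad_is_linear : linear (@dgrad R N).
Proof. by move=> k phi psi; apply/matrixP => x y; rewrite !mxE; ring. Qed.

Lemma ddiv_at_is_linear : linear (ddiv_at K mu).
Proof.
move=> k Phi Psi; apply/rowP => x; rewrite !mxE mulrCA [k * _]mulr_sumr -mulrDr.
rewrite -big_split; congr (_ * _); apply: eq_bigr => y _.
by rewrite !mxE /=; ring.
Qed.

HB.instance Definition _ :=
  GRing.isLinear.Build R 'rV[R]_N 'M[R]_N _ (@dgrad R N) dgrad_is_linear.
HB.instance Definition _ :=
  GRing.isLinear.Build R 'M[R]_N 'rV[R]_N _ (ddiv_at K mu) ddiv_at_is_linear.

(** Exchanging [x] and [y] in [S] keeps the weight, by reversibility and symmetry of the logarithmic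
    mean. Averaging the two forms of [S] turns [phi] into its gradient. *)
Lemma dgrad_parts phi psi :
  inner varpi phi (ddiv_at K mu (dgrad psi)) =
  - inner_at K varpi mu (dgrad phi) (dgrad psi).
Proof.
pose S := \sum_x \sum_y phi 0 x * (psi 0 y - psi 0 x) *
  (hat mu x y * K x y * varpi 0 x).
have ES : inner varpi phi (ddiv_at K mu (dgrad psi)) = S.
  apply: eq_bigr => x _; rewrite ddiv_at_dgradE mulr_sumr mulr_suml.
  by apply: eq_bigr => y _; ring.
have ES' : S = \sum_x \sum_y phi 0 y * (psi 0 x - psi 0 y) *
    (hat mu x y * K x y * varpi 0 x).
  rewrite /S exchange_big; apply: eq_bigr => x _; apply: eq_bigr => y _.
  by rewrite -!mulrA varpi_reversible !mxE logmeanC.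
have : S + S = - \sum_x \sum_y dgrad phi x y * dgrad psi x y *
    hat mu x y * K x y * varpi 0 x.
  rewrite {2}ES' /S -big_split -sumrN; apply: eq_bigr => x _ /=.
  rewrite -big_split -sumrN; apply: eq_bigr => y _ /=.
  by rewrite ![dgrad _ _ _]mxE; ring.
by rewrite ES /inner_at => SS; rewrite -mulrN -SS; field.
Qed.

Let hat_gt0 x y : 0 < hat mu x y.
Proof. by rewrite mxE logmean_gt0. Qed.

Let varpi_gt0 : forall x, 0 < varpi 0 x.
Proof. exact: steady_state_gt0 varpi_steady. Qed.

Let energy_ge0 (Psi : 'M[R]_N) x y :
  0 <= Psi x y * Psi x y * hat mu x y * K x y * varpi 0 x.
Proof.
apply: mulr_ge0; last exact: ltW.
apply: mulr_ge0; last exact: K_markov.1.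
by apply: mulr_ge0; [rewrite -expr2 sqr_ge0 | exact: ltW]. Qed.

(** Every summand of the energy is nonnegative, hence zero, so [psi] is constant along each edge
    with [K y z > 0] and its level sets are closed under transitions. *)
Lemma inner_at_dgrad_eq0 psi :
  inner_at K varpi mu (dgrad psi) (dgrad psi) = 0 ->
  forall x y, psi 0 x = psi 0 y.
Proof.
move=> /eqP; rewrite mulf_eq0 invr_eq0 pnatr_eq0 /= => /eqP energy0 x.
apply: (irreducible_closed_set _ K_markov K_irreducible
          (fun y => psi 0 x = psi 0 y)) => // y z -> Kyz.
have row0 := psumr_eq0P (fun u _ => sumr_ge0 _ (fun v _ => energy_ge0 _ u v))
  energy0 (i := y) isT.
have /eqP := psumr_eq0P (fun v _ => energy_ge0 _ y v) row0 (i := z) isT.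
rewrite !mulf_eq0 orbb (gt_eqF Kyz) (gt_eqF (hat_gt0 y z)).
by rewrite (gt_eqF (varpi_gt0 y)) !orbF mxE subr_eq0 => /eqP.
Qed.

Lemma laplacian_vlog : laplacian K mu = ddiv_at K mu (dgrad (vlog mu)).
Proof.
apply/rowP => x; rewrite ddiv_at_dgradE mxE mulr_sumr; apply: eq_bigr => y _.
rewrite !mxE [X in _ = X * _]mulrC logmean_mul_lnB //.
by field.
Qed.

Variable p : 'rV[R]_N.
Hypothesis p_mass : \sum_x varpi 0 x * p 0 x = 1.

(** The common source of uniqueness of decompositions and injectivity of [sharp]. Pairing with the
    constant 1 annihilates the divergence and leaves [h], as [p] has mass 1; then the energy of
    [psi] vanishes. *)
Lemma scaled_p_eq_ddiv_at h psi :
  h *: p = ddiv_at K mu (dgrad psi) ->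
  h = 0 /\ forall x y, psi 0 x = psi 0 y.
Proof.
move=> hp; have h0 : h = 0.
  have : inner varpi (const_mx 1) (h *: p) = 0.
    rewrite hp dgrad_parts /inner_at big1 ?mulr0 ?oppr0 // => x _.
    by rewrite big1 // => y _; rewrite !mxE; ring.
  rewrite -[_ *: _]addr0 inner_linear inner0 inner_const p_mass.
  by rewrite !mulr1 addr0.
split=> //; apply: inner_at_dgrad_eq0; apply/eqP.
by rewrite -oppr_eq0 -dgrad_parts -hp h0 scale0r inner0.
Qed.

(** Two decompositions of [rho] differ by a solution of [h *: p = ddiv_at K mu (dgrad psi)]. The
    potentials may still differ by a constant, which [dgrad] erases. *)
Lemma decomposition_subset1 rho : is_subset1 (decomposition K p mu rho).
Proof.
move=> [_ h] [_ h'] [/= [psi ->] eq_h] [/= [psi' ->] eq_h'].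
have [] := @scaled_p_eq_ddiv_at (h - h') (psi - psi').
  by rewrite scalerBl -eq_h -eq_h' !raddfB /= opprD addrACA subrr add0r.
move=> /subr0_eq -> psi_cst; congr (_, _); apply/matrixP => x y.
rewrite !mxE; apply/subr0_eq; have := psi_cst y x; rewrite !mxE => /eqP.
by rewrite -subr_eq0 => /eqP <-; ring.
Qed.

(** * The inverse of the metric *)

Section Sharp.
Variables a b : R.
Hypothesis a_neq0 : a != 0.
Hypothesis b_neq0 : b != 0.

(** The index-raising map of the metric, with a covector written as [inner varpi f]. *)
Definition sharp f : 'rV[R]_N :=
  (a ^- 2 * inner varpi f p) *: p - b ^- 2 *: ddiv_at K mu (dgrad f).

Lemma sharp_is_linear : linear sharp.
Proof.
move=> k f g; rewrite /sharp innerC inner_linear !linearP /=.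
rewrite ![inner _ p _]innerC.
by apply/rowP => x; rewrite !mxE; ring.
Qed.

HB.instance Definition _ :=
  GRing.isLinear.Build R 'rV[R]_N 'rV[R]_N _ sharp sharp_is_linear.

(** In finite dimension injectivity suffices: the square matrix of [sharp] has trivial kernel, hence
    is invertible. *)
Lemma sharp_surj rho : exists f, sharp f = rho.
Proof.
have sharp_inj (f : 'rV[R]_N) : f *m lin1_mx sharp = 0 -> f = 0.
  (* [sharp f = 0] reads [h *: p = ddiv_at K mu (dgrad psi)] with [h = a ^- 2 * inner varpi f p] and
     [psi = b ^- 2 *: f]. *)
  rewrite mul_rV_lin1 => /subr0_eq; rewrite -!linearZ => /scaled_p_eq_ddiv_at.
  move=> [/eqP]; rewrite mulf_eq0 invr_eq0 expf_eq0 /= (negPf a_neq0) /=.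
  move=> /eqP fp0 f_cst; apply/rowP => x; rewrite mxE.
  have f_constE : f = const_mx (f 0 x).
    apply/rowP => y; rewrite [RHS]mxE; have := f_cst y x; rewrite !mxE.
    by apply: mulfI; rewrite invr_eq0 expf_eq0.
  by move: fp0; rewrite f_constE inner_const p_mass mulr1 -f_constE.
have /inj_row_free := sharp_inj; rewrite row_free_unit => sharp_unit.
by exists (rho *m invmx (lin1_mx sharp)); rewrite -mul_rV_lin1 mulmxKV.
Qed.

Lemma decomp_sharp f :
  decomp K p mu (sharp f) = (dgrad (b ^- 2 *: f), a ^- 2 * inner varpi f p).
Proof.
apply: xget_subset1; last exact: decomposition_subset1.
by split; [exists (b ^- 2 *: f) | rewrite /= !linearZ subrK].
Qed.

Lemma metric_sharp f v : metric K varpi p a b mu (sharp f) v = inner varpi f v.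
Proof.
(* Once [v] is written as [sharp g], both decompositions are explicit, and integration by parts
   turns the energy of [f] and [g] into a pairing of [f] with a divergence. *)
have [g <-] := sharp_surj v; rewrite /metric !decomp_sharp /=.
rewrite -[inner_at _ _ _ _ _]opprK -dgrad_parts.
rewrite [sharp g]addrC -scaleNr inner_linear -[(_ * _) *: p]addr0.
rewrite inner_linear inner0 !linearZ /=.
rewrite -[_ *: ddiv_at _ _ _]addr0 inner_linear inner0.
rewrite [inner _ (_ *: f) _]innerC -[_ *: f]addr0 inner_linear inner0.
rewrite [inner _ (ddiv_at _ _ _) f]innerC.
by field; rewrite a_neq0 b_neq0.
Qed.

Lemma metric_nondegenerate G G' :
  (forall v, metric K varpi p a b mu G v = metric K varpi p a b mu G' v) ->
  G = G'.
Proof.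
have [[f <-] [g <-]] := (sharp_surj G, sharp_surj G') => eq_metric.
(* Testing against [delta_mx 0 x] isolates [f 0 x * varpi 0 x], and [varpi 0 x] is positive. *)
congr sharp; apply/rowP => x; have := eq_metric (delta_mx 0 x).
by rewrite !metric_sharp !inner_delta; apply: mulIf; rewrite gt_eqF.
Qed.

Lemma heat_field_sharp : heat_field K varpi p a b mu = - sharp (vlog mu).
Proof. by rewrite /heat_field laplacian_vlog opprB. Qed.

End Sharp.

End Weighted_laplacian.

(** * Differential of the entropy *)

Lemma is_diff_sum {R : numFieldType} {V W : normedModType R} {I : Type}
    (r : seq I) (f df : I -> V -> W) (x : V) :
  (forall i, is_diff x (f i) (df i)) ->
  is_diff x (\sum_(i <- r) f i) (\sum_(i <- r) df i).
Proof.
move=> fdf; elim/big_ind2: _ => // [|g dg h dh gdg hdh].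
  exact: is_diff_cst.
exact: is_diffD.
Qed.

Lemma is_diff_coord {R : numFieldType} {m n : nat} (M : 'M[R]_(m, n)) i j :
  is_diff M (fun A : 'M[R]_(m, n) => A i j) (fun A : 'M[R]_(m, n) => A i j).
Proof.
have coord_linear : linear (fun A : 'M[R]_(m, n) => A i j).
  by move=> k A B; rewrite !mxE.
pose coordM := GRing.isLinear.Build _ _ _ _ _ coord_linear.
(* Packing the projection as a linear map lets [diff_lin] equate its differential with the map
   itself. *)
pose coord : {linear 'M[R]_(m, n) -> R} :=
  HB.pack (fun A : 'M[R]_(m, n) => A i j) coordM.
apply: DiffDef; first exact: differentiable_coord.
rewrite (_ : (fun _ => _) = coord) // diff_lin //; exact: coord_continuous.
Qed.

Section Entropy_differential.
Context {R : realType} {N : nat} (varpi mu : 'rV[R]_N).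
Hypothesis mu_gt0 : Mplus mu.

(** The chain rule applies to each coordinate, since [phi] has derivative [ln] at positive
    points. *)
Lemma is_diff_entropy :
  is_diff mu (entropy varpi) (inner varpi (vlog mu)).
Proof.
pose phi (u : R) : R := u * ln u - u.
have phi_diff x : is_diff (mu 0 x) phi ( *:%R ^~ (ln (mu 0 x))).
  have mux := mu_gt0 x.
  have phi_der : is_derive (mu 0 x) 1 phi (ln (mu 0 x)).
    have ln_der := is_derive1_ln mux.
    apply: is_derive_eq.
    by rewrite /GRing.scale /= mulfV ?gt_eqF //; ring.
  have /derivable1_diffP phi_d : derivable phi (mu 0 x) 1 by [].
  by apply: DiffDef => //; rewrite diff1E // derive1E derive_val.
have -> : entropy varpi =
    \sum_x varpi 0 x *: (phi \o (fun nu : 'rV[R]_N => nu 0 x)).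
  apply/funext => nu; rewrite fct_sumE; apply: eq_bigr => x _.
  by rewrite [RHS]mulrC.
have -> : inner varpi (vlog mu) = \sum_x varpi 0 x *:
    ( *:%R ^~ (ln (mu 0 x)) \o (fun v : 'rV[R]_N => v 0 x)).
  apply/funext => v; rewrite fct_sumE; apply: eq_bigr => x _.
  by rewrite mxE [RHS]mulrC; congr (_ * _); exact: mulrC.
apply: is_diff_sum => x; apply: is_diffZ; apply: is_diff_comp.
exact: is_diff_coord.
Qed.

End Entropy_differential.

(** * Comparison of the two flows *)

Lemma eq_solution {R : realType} {N : nat} (F G : 'rV[R]_N -> 'rV[R]_N) I rho :
  (forall mu, Mplus mu -> F mu = G mu) -> solution F I rho -> solution G I rho.
Proof.
move=> FG [rho_gt0 rho_cont rho_der]; split=> // t It.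
(* An interior time lies in [I], so [rho t] is in [Mplus], where the fields agree. *)
by rewrite -FG; [exact: rho_der | apply: rho_gt0; exact: interior_subset It].
Qed.

Lemma eq_induced_semigroup {R : realType} {N : nat}
    (F G : 'rV[R]_N -> 'rV[R]_N) S :
  (forall mu, Mplus mu -> F mu = G mu) ->
  induced_semigroup F S -> induced_semigroup G S.
Proof.
move=> FG [S0 SD S_sol S_uniq]; split=> // [mu mu_gt0|T rho T0 rho_sol].
  exact: eq_solution (S_sol mu mu_gt0).
by apply: S_uniq T0 _; apply: eq_solution rho_sol => mu /FG.
Qed.

Theorem proposition4p3 (R : realType) (N : nat)
    (K : 'M[R]_N) (varpi p : 'rV[R]_N) (a b : R)
    (K_markov : markov_kernel K)
    (K_irreducible : irreducible_kernel K)
    (varpi_steady : steady_state K varpi)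
    (varpi_reversible : reversible K varpi)
    (a_gt0 : 0 < a) (b_gt0 : 0 < b)
    (p_Mplus : Mplus p) (p_mass : \sum_x varpi 0 x * p 0 x = 1) :
  let H : 'rV[R]_N -> R := entropy varpi in
  let heat : 'rV[R]_N -> 'rV[R]_N := heat_field K varpi p a b in
  let gradH : 'rV[R]_N -> 'rV[R]_N := riem_grad K varpi p a b H in
  [/\ forall mu, Mplus mu ->
        is_riem_grad K varpi p a b H mu (gradH mu) /\ heat mu = - gradH mu,
      forall (I : interval R) (rho : R -> 'rV[R]_N),
        solution heat I rho <-> solution (fun mu => - gradH mu) I rho
    & forall S : R -> 'rV[R]_N -> 'rV[R]_N,
        induced_semigroup heat S <->
        induced_semigroup (fun mu => - gradH mu) S].
Proof.
move=> H heat gradH.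
have a_neq0 : a != 0 by rewrite gt_eqF.
have b_neq0 : b != 0 by rewrite gt_eqF.
have grad_heat mu : Mplus mu ->
    is_riem_grad K varpi p a b H mu (gradH mu) /\ heat mu = - gradH mu.
  move=> mu_gt0; have H_diff := is_diff_entropy varpi mu mu_gt0.
  have sharp_grad : is_riem_grad K varpi p a b H mu
      (sharp K varpi mu p a b (vlog mu)).
    by split=> // v; rewrite metric_sharp // diff_val.
  have gradHE : gradH mu = sharp K varpi mu p a b (vlog mu).
    (* Gradients are unique by nondegeneracy of the metric, so the choice operator [xget] returns
       this one. *)
    apply: xget_subset1 => // G G' [_ HG] [_ HG'].
    apply: (@metric_nondegenerate _ _ K varpi mu _ _ _ _ _ p _ a b) => // v.
    by rewrite HG HG'.
  by rewrite gradHE; split=> //; apply: heat_field_sharp.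
have heatE mu : Mplus mu -> heat mu = - gradH mu by move=> /grad_heat[].
split=> // [I rho|S]; split.
- exact: eq_solution.
- by apply: eq_solution => mu /heatE.
- exact: eq_induced_semigroup.
- by apply: eq_induced_semigroup => mu /heatE.
Qed.
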